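(* Let $Z$ be a uniformly convex Banach space, let $W \subset Z$ be a nonempty closed convex subset, and let $K : W \to W$ be a nonexpansive mapping with $F(K) \neq \emptyset$. Let $a, b \in (0,1)$ and let $\{\alpha_n\}$, $\{\beta_n\}$ be sequences with $\alpha_n, \beta_n \in (a,b) \subset (0,1)$ for all $n \in \mathbb{N}$. Let $s_1 \in W$ and let $\{s_n\}$ be defined for all $n \in \mathbb{N}$ by $$r_n = (1-\beta_n)s_n + \beta_n K s_n, \qquad s_{n+1} = (1-\alpha_n) r_n + \alpha_n K s_n .$$ Then $\{s_n\}$ converges strongly (in norm) to a point of $F(K)$ if and only if $\liminf_{n\to\infty} d(s_n, F(K)) = 0$.
   Context: $F(K) = \{w \in W : Kw = w\}$ denotes the set of fixed points of $K$, and $d(s, F(K)) = \inf\{\|s-t\| : t \in F(K)\}$. $K : W \to W$ is nonexpansive if $\|Kx - Ky\| \le \|x-y\|$ for all $x,y \in W$. *)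

(* Defs.v *)
From HB Require Import structures.
From mathcomp Require Import all_boot all_order all_algebra.
From mathcomp Require Import all_classical all_reals all_analysis.
Import Order.TTheory GRing.Theory Num.Theory.
Import numFieldNormedType.Exports.

Set Implicit Arguments.
Unset Strict Implicit.
Unset Printing Implicit Defensive.

Local Open Scope classical_set_scope.
Local Open Scope ring_scope.

Definition uniformly_convex (R : realType) (Z : normedModType R) : Prop :=
  forall eps : R, 0 < eps -> eps <= 2 ->
    exists2 delta : R, 0 < delta &
      forall x y : Z, `|x| <= 1 -> `|y| <= 1 -> eps <= `|x - y| ->
        `|2^-1 *: (x + y)| <= 1 - delta.

Definition nonexpansive (R : realType) (Z : normedModType R) (W : set Z)
    (K : Z -> Z) : Prop :=
  forall x y : Z, W x -> W y -> `|K x - K y| <= `|x - y|.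

Definition fixed_points (Z : Type) (W : set Z) (K : Z -> Z) : set Z :=
  [set w | W w /\ K w = w].

(* [inf] of the empty set is the junk value 0, so this is the distance to [A]
   only when [A] is nonempty. *)
Definition dist_set (R : realType) (Z : normedModType R) (x : Z) (A : set Z)
    : R :=
  inf [set `|x - t| | t in A].

(* Main.v *)
(**
The iteration is Fejer monotone: the distance from [s n] to a fixed point
never increases.  Hence once some [s N] is within [e] of a fixed point [t], the
whole tail of [s] lies in the ball of center [t] and radius [e]; if such [N] and
[t] exist for every [e], then [s] is Cauchy, and its limit, being a limit of
fixed points, is fixed.
*)
Require Import Defs.
From HB Require Import structures.
From mathcomp Require Import all_boot all_order all_algebra.
From mathcomp Require Import all_classical all_reals all_analysis.
Import Order.TTheory GRing.Theory Num.Theory.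
Import numFieldNormedType.Exports.

Local Open Scope classical_set_scope.
Local Open Scope ring_scope.

Lemma convex_set_comb (R : realType) (Z : normedModType R) (W : set Z)
    (x y : Z) (t : R) :
  convex_set W -> W x -> W y -> 0 <= t -> t <= 1 ->
  W ((1 - t) *: x + t *: y).
Proof.
move=> cW Wx Wy t0 t1.
have := cW y x (Itv01 t0 t1).
by rewrite !inE addrC => /(_ Wy Wx).
Qed.

(** Closed balls are convex. Fejer monotonicity rests on this, since each step of the iteration is a
    nested convex combination. *)
Lemma dist_convex_comb (R : realType) (Z : normedModType R)
    (x y p : Z) (t m : R) :
  0 <= t -> t <= 1 -> `|x - p| <= m -> `|y - p| <= m ->
  `|(1 - t) *: x + t *: y - p| <= m.
Proof.
move=> t0 t1 xm ym.
have -> : (1 - t) *: x + t *: y - p = (1 - t) *: (x - p) + t *: (y - p).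
  by rewrite !scalerBr addrACA -opprD -scalerDl subrK scale1r.
have t1' : 0 <= 1 - t by rewrite subr_ge0.
rewrite (le_trans (ler_normD _ _))// !normrZ !ger0_norm//.
have -> : m = (1 - t) * m + t * m by rewrite -mulrDl subrK mul1r.
by rewrite lerD// ler_wpM2l.
Qed.

Section dist_set.
Context (R : realType) (Z : normedModType R).
Implicit Types (x t : Z) (A : set Z).

Lemma dist_set_ge0 x A : 0 <= dist_set x A.
Proof.
(* The bound survives an empty [A], where the infimum takes its default value 0. *)
rewrite /dist_set; have [->|/set0P[t At]] := eqVneq A set0.
  by rewrite image_set0 inf0.
by apply: lb_le_inf => [|_ [u _ <-]//]; exists `|x - t|, t.
Qed.

Lemma dist_set_le x t A : A t -> dist_set x A <= `|x - t|.
Proof.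
by move=> At; apply: ge_inf; [exists 0 => _ [u _ <-]|exists t].
Qed.

Lemma dist_set_lt x A (e : R) : A !=set0 -> dist_set x A < e ->
  exists2 t, A t & `|x - t| < e.
Proof.
move=> [u Au] /inf_lt[|_ [t At <-] te]; first by exists `|x - u|, u.
by exists t.
Qed.

End dist_set.

(** The lower limit is the limit of the tail infima: if every [u n] were at least [e], so would be
    each of these infima, and hence their limit. *)
Lemma limn_einf0_lt (R : realType) (u : nat -> R) (e : R) :
  0 < e -> limn_einf (EFin \o u) = 0%:E -> exists n, u n < e.
Proof.
move=> e0 u0; apply: contrapT => /forallNP une.
suff : (e%:E <= limn_einf (EFin \o u))%E by rewrite u0 lee_fin leNgt e0.
rewrite limn_einf_lim; apply: lime_ge; first exact: is_cvg_einfs.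
apply: nearW => n; apply: le_ereal_inf_tmp => _ [m _ <-].
by rewrite lee_fin leNgt; exact/negP.
Qed.

(** For a fixed point [t], the triangle inequality through [t = K t] bounds the distance from [K p]
    to [p] by twice that from [p] to [t]; hence the choice of [t] within [e / 2]. *)
Lemma nonexpansive_limit_fixed (R : realType) (Z : normedModType R)
    (W : set Z) (K : Z -> Z) (p : Z) :
  nonexpansive W K -> W p ->
  (forall e : R, 0 < e -> exists2 t, fixed_points W K t & `|p - t| < e) ->
  K p = p.
Proof.
move=> Kne Wp close; apply/subr0_eq/eqP; rewrite -normr_le0.
apply/ler_addgt0Pr => e e0; rewrite add0r.
have [t [Wt Kt] pt] := close _ (divr_gt0 e0 (ltr0n R 2)).
rewrite (le_trans (ler_distD t _ _))// [e]splitr lerD//.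
  by rewrite -{1}Kt (le_trans (Kne _ _ Wp Wt))// ltW.
by rewrite distrC ltW.
Qed.

Lemma fejer_cvg_fixed (R : realType) (Z : completeNormedModType R)
    (W : set Z) (K : Z -> Z) (s : nat -> Z) :
  closed W -> nonexpansive W K -> (forall n, W (s n)) ->
  (forall p, fixed_points W K p -> forall n, `|s n.+1 - p| <= `|s n - p|) ->
  (forall e : R, 0 < e ->
    exists N, exists2 t, fixed_points W K t & `|s N - t| < e) ->
  exists2 p : Z, fixed_points W K p & s n @[n --> \oo] --> p.
Proof.
move=> clW Kne Ws fejer close.
have tail e : 0 < e -> exists2 t, fixed_points W K t &
    \forall n \near \oo, `|s n - t| < e.
  move=> /close[N [t Ft sNt]]; exists t => //; exists N => // n /= Nn.
  apply: le_lt_trans sNt.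
  by have /nonincreasing_seqP := fejer t Ft; apply.
have /cvg_ex[p sp] : cvgn s.
  (* This form of the Cauchy criterion asks only for some ball of radius [e] containing a tail; its
     center can be the fixed point [t], which need not be a term of [s]. *)
  apply/cauchy_cvgP/cauchy_exP => e /tail[t _ st]; exists t.
  by apply: filterS st => n; rewrite -ball_normE /= distrC.
have Wp : W p by apply: closed_cvg sp => //; exact: nearW.
exists p => //; split=> //; apply: (nonexpansive_limit_fixed _ _ _ _ _ Kne Wp) => e e0.
have [t Ft st] := tail _ (divr_gt0 e0 (ltr0n R 2)); exists t => //.
(* Some late term [s n] is within [e / 2] of both [t] and [p], and so links the two. *)
have /cvgr_dist_lt/(_ _ (divr_gt0 e0 (ltr0n R 2))) sp' := sp.
have [n [snt psn]] := filter_ex (filterI st sp').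
by rewrite (le_lt_trans (ler_distD (s n) _ _))// [e]splitr ltrD.
Qed.

Theorem theorem3p4 (R : realType) (Z : completeNormedModType R)
    (Z_uc : uniformly_convex Z)
    (W : set Z) (W_neq0 : W !=set0) (W_closed : closed W)
    (W_convex : convex_set W)
    (K : {fun W >-> W}) (K_nonexp : nonexpansive W K)
    (FK_neq0 : fixed_points W K !=set0)
    (a b : R) (a01 : 0 < a < 1) (b01 : 0 < b < 1)
    (alpha beta : nat -> R)
    (alphaP : forall n, a < alpha n < b) (betaP : forall n, a < beta n < b)
    (s r : nat -> Z) (s0W : W (s 0%N))
    (rE : forall n, r n = (1 - beta n) *: s n + beta n *: K (s n))
    (sE : forall n, s n.+1 = (1 - alpha n) *: r n + alpha n *: K (s n)) :
  (exists2 p : Z, fixed_points W K p & s n @[n --> \oo] --> p) <->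
  limn_einf (fun n => (dist_set (s n) (fixed_points W K))%:E) = 0%:E.
Proof.
pose F := fixed_points W K.
have WK x : W x -> W (K x) by move=> Wx; exact: (@funS _ _ _ _ K).
have in01 (c : R) : a < c < b -> 0 <= c /\ c <= 1.
  case/andP: a01 => a0 _; case/andP: b01 => _ b1 /andP[ac cb].
  by split; apply: ltW; [exact: lt_trans ac|exact: lt_trans b1].
have Wstep n : W (s n) -> W (s n.+1).
  move=> Wn; have [? ?] := in01 _ (alphaP n); have [? ?] := in01 _ (betaP n).
  by rewrite sE rE; do 2?apply: convex_set_comb => //; exact: WK.
have Ws n : W (s n) by elim: n => // n /Wstep.
have fejer p : F p -> forall n, `|s n.+1 - p| <= `|s n - p|.
  move=> [Wp Kp] n.
  have [? ?] := in01 _ (alphaP n); have [? ?] := in01 _ (betaP n).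
  have Kn : `|K (s n) - p| <= `|s n - p| by rewrite -{1}Kp; exact: K_nonexp.
  (* The outer combination joins [r n] to [K (s n)], the inner one [s n] to [K (s n)]; both [s n]
     and [K (s n)] lie in the closed ball about [p] of radius [|s n - p|]. *)
  by rewrite sE rE; do 2?apply: dist_convex_comb.
split=> [[p Fp sp]|d0].
  (* A convergent sequence has its limit as lower limit, so it suffices to squeeze the distance to
     [F] between 0 and [|s n - p|]. *)
  suff /cvg_limn_einf_sup[] : (dist_set (s n) F)%:E @[n --> \oo] --> 0%:E by [].
  apply/fine_cvgP; split; first exact: nearW.
  apply: (@squeeze_cvgr _ _ _ _ (cst 0) (fun n => `|s n - p|)).
  - by apply: nearW => n /=; rewrite dist_set_ge0 dist_set_le.
  - exact: cvg_cst.
  - by apply/norm_cvg0P; apply/subr_cvg0.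
apply: (fejer_cvg_fixed _ _ _ _ _ W_closed K_nonexp Ws fejer) => e e0.
have [N dN] := limn_einf0_lt _ _ _ e0 d0.
(* Since [F] is nonempty, the infimum is a genuine distance and some fixed point comes within [e] of
   [s N]. *)
by exists N; exact: dist_set_lt _ _ _ _ _ FK_neq0 dN.
Qed.
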